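(* Let $(\mathfrak n,g)$ be an irreducible $2$-step nilpotent metric Lie algebra, with center $\mathfrak z$, orthogonal decomposition $\mathfrak n=\mathfrak v\oplus\mathfrak z$, and associated map $j:\mathfrak z\to\mathfrak{so}(\mathfrak v)$. Then $\mathfrak n$ admits a non-zero Killing $3$-form if and only if the following two conditions hold: (1) $j(\mathfrak z)$ is a Lie subalgebra of $\mathfrak{so}(\mathfrak v)$; (2) for each $z\in\mathfrak z$, the map $\mathfrak z\to\mathfrak z$, $z'\mapsto j^{-1}[j(z),j(z')]$, is in $\mathfrak{so}(\mathfrak z)$. In this case, the space of Killing $3$-forms on $\mathfrak n$ is one-dimensional.
   Context: A real finite-dimensional Lie algebra $\mathfrak n$ is $2$-step nilpotent if it is non-abelian and $[\mathfrak n,\mathfrak n]$ is contained in its center $\mathfrak z$. A metric Lie algebra $(\mathfrak n,g)$ is a Lie algebra with an inner product; it is reducible if it is an orthogonal direct sum of two non-zero ideals, and irreducible otherwise. $\mathfrak v$ is the orthogonal complement of $\mathfrak z$ in $\mathfrak n$, and $j:\mathfrak z\to\mathfrak{so}(\mathfrak v)$ is the linear map defined by $g(j(z)x,y)=g(z,[x,y])$ for $x,y\in\mathfrak v$, $z\in\mathfrak z$; here $\mathfrak{so}(V)$ denotes the skew-symmetric endomorphisms of a Euclidean space $V$. When $(\mathfrak n,g)$ is irreducible, $j$ is injective, so $j^{-1}$ is defined on $j(\mathfrak z)$. Let $N$ be the simply connected Lie group with Lie algebra $\mathfrak n$, with the left-invariant Riemannian metric induced by $g$ and Levi-Civita connection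 $\nabla$. Left-invariant $k$-forms on $N$ are identified with elements of $\Lambda^k\mathfrak n^*$. A Killing $k$-form on $\mathfrak n$ is an $\alpha\in\Lambda^k\mathfrak n^*$ whose associated left-invariant form on $N$ is Killing, i.e. $\nabla_y\alpha=\frac1{k+1}\,y\lrcorner\, d\alpha$ for all $y\in\mathfrak n$ ($\lrcorner$ denotes contraction, $d$ the Lie algebra differential). *)

(* Defs.v *)
From HB Require Import structures.
From mathcomp Require Import all_boot all_order all_algebra.
From mathcomp Require Import classical_sets reals.
From mathcomp Require Import ring lra.

Set Implicit Arguments.
Unset Strict Implicit.
Unset Printing Implicit Defensive.

Import Order.TTheory GRing.Theory Num.Theory.
Local Open Scope ring_scope.

HB.mixin Record Vector_isLie (K : fieldType) L of Vector K L := {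
  lie : L -> L -> L;
  lie_bilinear : bilinear_for *:%R *:%R lie;
  liexx : forall x, lie x x = 0;
  lie_jacobi : forall x y z,
    lie x (lie y z) + lie y (lie z x) + lie z (lie x y) = 0
}.

#[short(type="lieAlgType")]
HB.structure Definition LieAlgebra (K : fieldType) :=
  { L of Vector K L & Vector_isLie K L }.

HB.instance Definition _ (K : fieldType) (L : lieAlgType K) :=
  bilinear_isBilinear.Build K L L L *:%R *:%R (@lie K L) lie_bilinear.
HB.instance Definition _ (K : fieldType) (L : lieAlgType K) (x : L) :=
  GRing.isLinear.Build K L L *:%R (lie x) (lie_bilinear.2 x).

Section EndLie.
Variables (K : fieldType) (U : vectType K).

Definition commutator (f h : 'End(U)) : 'End(U) := ((f \o h) - (h \o f))%VF.

Fact commutator_bilinear : bilinear_for *:%R *:%R commutator.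
Proof.
split=> u a f h /=; rewrite /commutator.
  by rewrite comp_lfunDl comp_lfunDr -comp_lfunZl -comp_lfunZr scalerBr opprD addrACA.
by rewrite comp_lfunDl comp_lfunDr -comp_lfunZl -comp_lfunZr scalerBr opprD addrACA.
Qed.

Fact commutatorxx f : commutator f f = 0.
Proof. exact: subrr. Qed.

Fact commutator_jacobi f h k :
  commutator f (commutator h k) + commutator h (commutator k f)
  + commutator k (commutator f h) = 0.
Proof.
rewrite /commutator; apply/lfunP => u.
rewrite !(add_lfunE, opp_lfunE, comp_lfunE, zero_lfunE) !linearB /=.
have swap (p q r t : U) : p - q + (- r - - t) = (p + t) - (r + q).
  by rewrite opprK [- r + t]addrC addrACA opprD [- q - r]addrC.
by rewrite !swap addrA subrKA subrK subrr.
Qed.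

HB.instance Definition _ := Vector_isLie.Build K 'Hom(U, U)
  commutator_bilinear commutatorxx commutator_jacobi.

End EndLie.

Section LieTheory.
Variables (K : fieldType) (L : lieAlgType K).

Definition ad (x : L) : 'End(L) := linfun (lie x).

Lemma adE x y : ad x y = lie x y.
Proof. exact: lfunE. Qed.

Fact ad_linear : linear ad.
Proof.
move=> a x y; apply/lfunP => z.
by rewrite add_lfunE scale_lfunE !adE linearPl.
Qed.
HB.instance Definition _ :=
  GRing.isLinear.Build K L 'End(L) *:%R ad ad_linear.

Definition center : {vspace L} := lker (linfun ad).

Lemma centerP x : reflect (forall y, lie x y = 0) (x \in center).
Proof.
rewrite memv_ker lfunE; apply: (iffP eqP) => [adx0 y | x0].
  by rewrite -adE adx0 zero_lfunE.
by apply/lfunP => y; rewrite adE zero_lfunE.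
Qed.

(* Spanned by the brackets of basis vectors, as prodv is for products. *)
Definition brackv (U V : {vspace L}) : {vspace L} :=
  <<allpairs lie (vbasis U) (vbasis V)>>%VS.

Lemma brackvP (U V W : {vspace L}) :
  reflect {in U & V, forall x y, lie x y \in W} (brackv U V <= W)%VS.
Proof.
apply: (iffP span_subvP) => [sUVW x y | sUVW _ /allpairsP[[x y] /= [Ux Vy ->]]].
  move=> /coord_vbasis-> /coord_vbasis->.
  rewrite linear_sumlz memv_suml // => i _.
  rewrite linear_sumr memv_suml // => k _.
  rewrite linearZl_LR linearZr_LR /= !memvZ //; apply: sUVW.
  by apply: allpairs_f; rewrite mem_nth ?size_tuple.
by apply: sUVW; apply: vbasis_mem.
Qed.

Definition abelian_lie : Prop := forall x y : L, lie x y = 0.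

Definition two_step_nilpotent : Prop :=
  ~ abelian_lie /\ (brackv fullv fullv <= center)%VS.

Definition lie_ideal (I : {vspace L}) : Prop :=
  (brackv fullv I <= I)%VS.

Definition lie_subalgebra (W : {vspace L}) : Prop :=
  (brackv W W <= W)%VS.

Lemma lieC (x y : L) : lie x y = - lie y x.
Proof.
have := @liexx K L (x + y).
rewrite (linearDl (@lie K L)) !linearD /= !(@liexx K L) add0r addr0 => /eqP.
by rewrite addr_eq0 => /eqP.
Qed.

End LieTheory.

Section InnerProduct.
Variables (R : realType) (U : vectType R).
Implicit Type g : {dot U for idfun}.

Definition so g : set 'End(U) :=
  [set f : 'End(U) | forall x y, g (f x) y = - g x (f y)].

Definition subdot g (W : {vspace U}) (x y : subvs_of W) : R :=
  g (vsval x) (vsval y).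

Section Subdot.
Variables (g : {dot U for idfun}) (W : {vspace U}).

Fact subdot_bilinear :
  bilinear_for *%R ((idfun : R -> R) \; *%R) (subdot g (W := W)).
Proof.
split=> u a x y; rewrite /subdot linearP.
  exact: linearPl.
by [].
Qed.

Fact subdot_sym (x y : subvs_of W) :
  subdot g x y = (-1) ^+ false * idfun (subdot g y x).
Proof. exact: hermitian_subproof. Qed.

Fact subdot_gt0 (x : subvs_of W) : x != 0 -> 0 < subdot g x x.
Proof.
by move=> x0; apply: neq0_dnorm_gt0; rewrite -(inj_eq subvs_inj) linear0 in x0 *.
Qed.

HB.instance Definition _ := bilinear_isBilinear.Build R
  (subvs_of W) (subvs_of W) R ( *%R) (idfun \; *%R) (subdot g (W:=W)) subdot_bilinear.
HB.instance Definition _ := isHermitianSesquilinear.Build R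
  (subvs_of W) false idfun (subdot g (W:=W)) subdot_sym.
HB.instance Definition _ := isDotProduct.Build R
  (subvs_of W) (subdot g (W:=W)) subdot_gt0.

End Subdot.

End InnerProduct.

Arguments subdot {R U} g W x y.

Definition lie_subalgebra_of_so (R : realType) (U : vectType R)
    (g : {dot U for idfun}) (W : {vspace 'End(U)}) : Prop :=
  (forall f, f \in W -> so g f) /\ lie_subalgebra W.

Section DotForm.
Variables (R : realType) (U : vectType R) (g : {dot U for idfun}).

Lemma dotPl a x y z : g (a *: x + y) z = a * g x z + g y z.
Proof. exact: (linearPl g). Qed.

Lemma dotPr z a x y : g z (a *: x + y) = a * g z x + g z y.
Proof. by rewrite linearP. Qed.

Lemma dotNl x z : g (- x) z = - g x z.
Proof. exact: (linearNl g). Qed.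

Lemma dotBl x y z : g (x - y) z = g x z - g y z.
Proof. exact: (linearBl g). Qed.

Lemma dotC x y : g x y = g y x.
Proof. by rewrite hermitian_subproof expr0 mul1r. Qed.

Lemma dot_inj x y : (forall z, g x z = g y z) -> x = y.
Proof.
move=> xy; apply/eqP; rewrite -subr_eq0; apply/negPn/negP => xy0.
have := neq0_dnorm_gt0 (s := g) _ xy0.
by rewrite -[in X in g X _]scaleN1r [in X in g X _]addrC dotPl xy mulN1r addNr ltxx.
Qed.

Let linfunE (V W : vectType R) (f : V -> W) (fl : linear f) : linfun f =1 f.
Proof. exact: (lfunE (HB.pack f (GRing.isLinear.Build R V W *:%R f fl))). Qed.

Let flat : 'Hom(U, 'Hom(U, R^o)) :=
  linfun (fun x => linfun (g x : U -> R^o)).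

Let flatE x y : flat x y = g x y.
Proof.
have gl w : linear (g w : U -> R^o) by move=> a p q; exact: dotPr.
rewrite /flat linfunE ?linfunE // => a p q; apply/lfunP => w.
by rewrite add_lfunE scale_lfunE !(linfunE (gl _)) dotPl.
Qed.

Let flat_inj : lker flat == 0%VS.
Proof.
rewrite -subv0; apply/subvP => x; rewrite memv_ker memv0 => /eqP fx0.
apply/eqP/dot_inj => z.
by rewrite -flatE fx0 zero_lfunE linear0l.
Qed.

Let flat_full : limg flat = fullv.
Proof.
apply/eqP; rewrite eqEdim subvf limg_dim_eq ?(eqP flat_inj) ?capv0 //.
rewrite !dimvf; have ->: (dim 'Hom(U, R^o) = dim U * 1)%N by [].
by rewrite muln1 leqnn.
Qed.

Lemma dot_represent (T : vectType R) (F : T -> U -> U -> R^o) :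
  (forall x y, linear (fun t => F t x y)) ->
  (forall t y, linear (fun x => F t x y)) ->
  (forall t x, linear (F t x)) ->
  exists! h : 'Hom(T, 'End(U)), forall t x y, g (h t x) y = F t x y.
Proof.
move=> F1 F2 F3.
have Fl t x y : linfun (F t x) y = F t x y by rewrite linfunE.
pose s t x : U := (flat^-1)%VF (linfun (F t x)).
have sE t x y : g (s t x) y = F t x y.
  by rewrite -flatE limg_lfunVK ?flat_full ?memvf.
have s2 t : linear (s t).
  by move=> a x y; apply: dot_inj => z; rewrite dotPl !sE F2.
have s1 : linear (fun t => linfun (s t)).
  move=> a t u; apply/lfunP => x; rewrite add_lfunE scale_lfunE !linfunE //.
  by apply: dot_inj => z; rewrite dotPl !sE F1.
exists (linfun (fun t => linfun (s t))); split=> [t x y | h hE].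
  by rewrite !linfunE.
apply/lfunP => t; apply/lfunP => x; apply: dot_inj => y.
by rewrite hE !linfunE.
Qed.

End DotForm.

Section MetricLie.
Variables (R : realType) (n : lieAlgType R) (g : {dot n for idfun}).

Definition reducible : Prop :=
  exists A B : {vspace n},
    [/\ A != 0%VS, B != 0%VS, lie_ideal A, lie_ideal B
      & (A <= orthov g B)%VS /\ (A + B)%VS = fullv].

Definition irreducible : Prop := ~ reducible.

Local Notation z := (subvs_of (center n)).
Local Notation v := (subvs_of (orthov g (center n))).

Definition is_jmap (j : 'Hom(z, 'End(v))) : Prop :=
  forall (t : z) (x y : v),
    subdot g _ (j t x) y = g (vsval t) (lie (vsval x) (vsval y)).

Lemma jmap_exists : exists! j, is_jmap j.
Proof.
apply: (@dot_represent R v (subdot g _) z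
  (fun t x y => g (vsval t) (lie (vsval x) (vsval y)))) => [x y|t y|t x] a p q.
- by rewrite linearP dotPl.
- by rewrite !linearP linearPl dotPr.
- by rewrite !linearP.
Qed.

Lemma jmap_so j t : is_jmap j -> so (subdot g _) (j t).
Proof.
move=> jP x y; apply: etrans (jP t x y) _; rewrite lieC.
apply: (@etrans _ _ (- subdot g _ (j t y) x)); last by congr (- _); exact: dotC.
by rewrite jP dotC dotNl dotC.
Qed.

(* On left-invariant vector fields, the Levi-Civita connection of the
   left-invariant metric is the torsion-free metric connection; functions
   g(y, z) being constant there, metricity has no derivative term. *)
Definition levi_civita (nabla : 'Hom(n, 'End(n))) : Prop :=
  (forall x y, nabla x y - nabla y x = lie x y) /\
  (forall x y z, g (nabla x y) z + g y (nabla x z) = 0).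

Lemma levi_civita_exists : exists! nabla, levi_civita nabla.
Proof.
have liePl a (p q y : n) : lie (a *: p + q) y = a *: lie p y + lie q y.
  exact: (linearPl (@lie R n)).
have liePr (y : n) a p q : lie y (a *: p + q) = a *: lie y p + lie y q.
  exact: (linearPr (@lie R n)).
have [||| D [DE Duniq]] := @dot_represent R n g n (fun x y z =>
    2^-1 * (g (lie x y) z - g (lie y z) x + g (lie z x) y)).
- move=> x y a p q; rewrite !liePl !liePr !dotPl !dotPr /GRing.scale /=; ring.
- move=> x y a p q; rewrite !liePl !liePr !dotPl !dotPr /GRing.scale /=; ring.
- move=> x y a p q; rewrite !liePl !liePr !dotPl !dotPr /GRing.scale /=; ring.
exists D; split; first split=> [x y | x y w].
- apply: (dot_inj (g := g)) => w; rewrite -scaleN1r addrC dotPl !DE.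
  by rewrite (lieC y x) (lieC x w) (lieC w y) !dotNl; field.
- rewrite (dotC g y) !DE.
  by rewrite (lieC y x) (lieC x w) (lieC w y) !dotNl; field.
move=> D' [D'tor D'met]; apply: Duniq => x y w.
rewrite -!D'tor !dotBl.
have := D'met x y w; have := D'met y x w; have := D'met w x y.
rewrite ?(dotC g _ (D' _ _)); lra.
Qed.

End MetricLie.

Arguments is_jmap {R n} g j.

Section Forms.
Variables (R : realType) (n : lieAlgType R).

Definition kform (k : nat) : Type := ('I_k -> n) -> R.

Definition alternating k (alpha : kform k) : Prop :=
  (forall (x : 'I_k -> n) (i : 'I_k),
     scalar (fun y => alpha (fun l => if l == i then y else x l))) /\
  (forall (x : 'I_k -> n) (i l : 'I_k), i != l -> x i = x l -> alpha x = 0).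

(* (d alpha)(x_0, ..., x_k) is the sum over i < l of
   (-1)^(i + l) alpha([x_i, x_l], x_0, ..., x_k), with x_i and x_l omitted
   from the list x_0, ..., x_k. *)
Definition lie_diff k (alpha : kform k) : kform k.+1 := fun x =>
  \sum_(i < k.+1) \sum_(l < k.+1 | (i < l)%N)
    (-1) ^+ (i + l) *
    alpha (fun m : 'I_k =>
      nth 0 (lie (x i) (x l) :: [seq x p | p <- enum 'I_k.+1 & p \notin [:: i; l]]) m).

Definition contraction k (y : n) (alpha : kform k.+1) : kform k := fun x =>
  alpha (fun i => if unlift ord0 i is Some l then x l else y).

(* Derivation action of nabla_y; alpha(x_1, ..., x_k) is a constant function
   for left-invariant fields x_i, so it contributes no derivative term. *)
Definition cov_deriv k (nabla : 'Hom(n, 'End(n))) (y : n) (alpha : kform k) :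
    kform k := fun x =>
  - \sum_(i < k) alpha (fun l => if l == i then nabla y (x i) else x l).

Definition killing_form (nabla : 'Hom(n, 'End(n))) k
    (alpha : kform k) : Prop := alternating alpha /\
  forall (y : n) x,
    cov_deriv nabla y alpha x = k.+1%:R^-1 * contraction y (lie_diff alpha) x.

Definition one_dimensional k (S : set (kform k)) : Prop :=
  exists2 alpha, alpha <> (fun=> 0)
    & S = [set (fun x => c * alpha x) | c in setT]%classic.

End Forms.

(* Main.v *)
Require Import Defs.
From HB Require Import structures.
From mathcomp Require Import all_boot all_order all_algebra.
From mathcomp Require Import boolp classical_sets reals.
From mathcomp Require Import spectral complex.
From mathcomp Require Import ring lra.

(** Write [n = v + z], let [k] and [i] be the inclusions of [v] and [z], and let
    [x, y, b, c] range over [v] and [r, s, t] over [z].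

    A 3-form [a] is Killing exactly when [y |-> nabla_y a] is totally skew, that
    is, when [a (nabla_y y) b c + a y (nabla_y b) c + a y b (nabla_y c) = 0] on
    all of [n] (lemma [killing_form3]): as [nabla] is torsion free, [d a] is the
    skew-symmetrization of [nabla a].  On a 2-step nilpotent algebra [nabla] is
    explicit: [nabla_x y = [x, y] / 2], [nabla_x t = nabla_t x = - j_t x / 2] and
    [nabla_s t = 0].  Evaluating the identity on arguments in [v] and [z]
    separates the components of [a] of odd degree in [v] from those of even
    degree.

    The odd components vanish: [a (j_t x) r s] and [a (j_t x) y b] turn out to be
    skew in all three arguments, and one more instance of the identity then makes
    them equal to a multiple of their own opposite.  As the images of the maps
    [j_t] span [v], this suffices.

    The even part is given by skew maps [A_t] with [g (A_t x) y = a t x y] and by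
    [w] with [g (w r s) t = a r s t].  The identity yields
    [A_t j_s = j_t A_s], [j (w r s) = 2 (A_r j_s - j_s A_r)], and the symmetry in
    [b, c] of [g (A_[x, b] x) c].  The key point is that these force
    [A = lam j] (lemma [exchange_scalar]).  First, [K = \sum_i j_i ^ 2] over a
    basis of [z] is negative definite, since a common kernel vector of the [j_t]
    would be central; pushing [K] through [A_t] gives [A_t = S j_t = j_t S] for
    one symmetric [S] commuting with all [j_t].  Then an eigenspace of [S],
    together with the brackets of its elements, is an ideal whose orthogonal
    complement is an ideal too, so by irreducibility [S] is a scalar.

    Hence [j (w r s) = 2 lam [j_r, j_s]], and [a] is determined by [lam].  If
    [a <> 0] then [lam <> 0], so [[j_r, j_s] = j (h r s)] with
    [h = w / (2 lam)], and [g (h r s) t] is skew in [s, t] because [a] is: these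
    are conditions (1) and (2).  Conversely, they provide such an [h], and the
    cubic form with components [g (j_t x) y] and [2 g (h r s) t] is a non-zero
    Killing form, of which every other one is a multiple. *)

Set Implicit Arguments.
Unset Strict Implicit.
Unset Printing Implicit Defensive.

Import Order.TTheory GRing.Theory Num.Theory.
Local Open Scope ring_scope.

(** * Inner products *)

Section Dot.
Variables (R : realType) (U : vectType R) (g : {dot U for idfun}).

Lemma dotDl x y z : g (x + y) z = g x z + g y z.
Proof. by rewrite -[x]scale1r dotPl mul1r scale1r. Qed.

Lemma dotDr z x y : g z (x + y) = g z x + g z y.
Proof. by rewrite -[x]scale1r dotPr mul1r scale1r. Qed.

Lemma dot0l z : g 0 z = 0.
Proof. exact: linear0l. Qed.

Lemma dot0r z : g z 0 = 0.
Proof. exact: linear0. Qed.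

Lemma dotZl a x z : g (a *: x) z = a * g x z.
Proof. by rewrite -[a *: x]addr0 dotPl dot0l addr0. Qed.

Lemma dotZr a z x : g z (a *: x) = a * g z x.
Proof. by rewrite -[a *: x]addr0 dotPr dot0r addr0. Qed.

Lemma dotNr z x : g z (- x) = - g z x.
Proof. by rewrite -scaleN1r dotZr mulN1r. Qed.

Lemma dot_eq0 x : g x x = 0 -> x = 0.
Proof.
move=> gx; apply/eqP/negPn/negP => /(neq0_dnorm_gt0 (s := g)).
by rewrite gx ltxx.
Qed.

Lemma dot_ge0 x : 0 <= g x x.
Proof.
have [->|/(neq0_dnorm_gt0 (s := g))/ltW //] := eqVneq x 0.
by rewrite dot0l.
Qed.

Lemma dot_suml (I : finType) (F : I -> U) z :
  g (\sum_i F i) z = \sum_i g (F i) z.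
Proof. by rewrite linear_sumlz. Qed.

Lemma dot_sumr (I : finType) (F : I -> U) z :
  g z (\sum_i F i) = \sum_i g z (F i).
Proof. by rewrite dotC dot_suml; apply: eq_bigr => i _; rewrite dotC. Qed.

(** [mem_orthovP] speaks of the hermitian form underlying [g]; here it is
    restated with [g] itself so that the rules above apply. *)
Lemma mem_orthov (W : {vspace U}) u :
  u \in orthov g W <-> (forall w, w \in W -> g u w = 0).
Proof. by split=> [/mem_orthovP|h]; last apply/mem_orthovP. Qed.

(** The orthogonal of [W] is the kernel of the map sending [u] to the vector of
    its products with a basis of [W], so its dimension is at least
    [dim U - dim W]; and it meets [W] trivially by definiteness. *)
Lemma orthov_decomp (W : {vspace U}) u :
  exists w w', [/\ w \in W, w' \in orthov g W & u = w + w'].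
Proof.
pose F u : 'rV[R]_(\dim W) := \row_i g u (vbasis W)`_i.
have Fl : linear F by move=> a x y; apply/rowP => i; rewrite !mxE dotPl.
pose f := linfun (HB.pack F (GRing.isLinear.Build R U 'rV[R]_(\dim W) *:%R F Fl)
                 : {linear U -> 'rV[R]_(\dim W)}).
have fE v : f v = F v by rewrite lfunE.
have kerf : (lker f <= orthov g W)%VS.
  apply/subvP => v; rewrite memv_ker fE => /eqP Fv.
  apply/mem_orthov => w /coord_vbasis ->.
  rewrite dot_sumr big1 // => i _; rewrite dotZr.
  by have /rowP/(_ i) := Fv; rewrite !mxE => ->; rewrite mulr0.
have WW : (W :&: orthov g W = 0)%VS.
  apply/eqP; rewrite -subv0; apply/subvP => v; rewrite memv_cap => /andP[vW].
  by move=> /mem_orthov /(_ v vW) /dot_eq0 ->; rewrite mem0v.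
have full : (W + orthov g W)%VS = fullv.
  apply/eqP; rewrite eqEdim subvf dimv_disjoint_sum // -(limg_ker_dim f fullv).
  rewrite capfv addnC leq_add ?dimvS //.
  apply: leq_trans (dimvS (subvf _)) _.
  by rewrite dimvf /dim /= mul1n.
have := memvf u; rewrite -full => /memv_addP [w wW [w' wW' ->]].
by exists w, w'.
Qed.

Lemma orthov_eq0 (W : {vspace U}) :
  (forall u, u \in orthov g W -> u = 0) -> W = fullv.
Proof.
move=> W0; apply/eqP; rewrite eqEsubv subvf; apply/subvP => u _.
by have [w [w' [wW /W0 -> ->]]] := orthov_decomp W u; rewrite addr0.
Qed.

End Dot.

Section SymmetricEigenvalue.
Import VectorInternalTheory.
Variables (R : realType) (U : vectType R) (g : {dot U for idfun}).

(** The matrix of [S] has an eigenvector [p + i q] over the complex numbers, for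
    an eigenvalue [a].  Comparing [g (S p) q] with [g p (S q)] gives
    [Im a * (|p|^2 + |q|^2) = 0], so [a] is real, and [p] or [q] is a real
    eigenvector. *)
Lemma symmetric_eigenvector (S : 'End(U)) :
  (forall x y, g (S x) y = g x (S y)) -> (fullv : {vspace U}) != 0%VS ->
  exists lam u, u != 0 /\ S u = lam *: u.
Proof.
move=> Ssym U0.
have d0 : (0 < dim U)%N by rewrite -dimvf lt0n dimv_eq0.
pose toC := real_complex R.
have [a /eigenvalueP[c cS c0]] := eigenvalue_closed (map_mx toC (f2mx S)) d0.
pose rv (f : R[i] -> R) := r2v (map_mx f c) : U.
have Srv f : S (rv f) = r2v (map_mx f c *m f2mx S).
  by rewrite unlock /= r2vK.
have SRe : S (rv (@complex.Re R)) =
    complex.Re a *: rv (@complex.Re R) - complex.Im a *: rv (@complex.Im R).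
  rewrite Srv /rv -!linearZ -linearB; congr r2v; apply/rowP => k.
  have /rowP/(_ k) := cS; rewrite !mxE => /(congr1 (@complex.Re R)).
  rewrite raddf_sum /= => ReS.
  transitivity (complex.Re (a * c 0 k)); last by case: (a) (c 0 k) => [? ?] [? ?].
  rewrite -ReS; apply: eq_bigr => l _; rewrite !mxE.
  by case: (c 0 l) => p q /=; rewrite mulr0 subr0.
have SIm : S (rv (@complex.Im R)) =
    complex.Re a *: rv (@complex.Im R) + complex.Im a *: rv (@complex.Re R).
  rewrite Srv /rv -!linearZ -linearD; congr r2v; apply/rowP => k.
  have /rowP/(_ k) := cS; rewrite !mxE => /(congr1 (@complex.Im R)).
  rewrite raddf_sum /= => ImS.
  transitivity (complex.Im (a * c 0 k)); last by case: (a) (c 0 k) => [? ?] [? ?].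
  rewrite -ImS; apply: eq_bigr => l _; rewrite !mxE.
  by case: (c 0 l) => p q /=; rewrite mulr0 add0r.
set p := rv (@complex.Re R) in SRe SIm; set q := rv (@complex.Im R) in SRe SIm.
have pq0 : p = 0 -> q = 0 -> False.
  move=> /(congr1 v2r) + /(congr1 v2r).
  rewrite !r2vK !linear0 => /rowP p0 /rowP q0.
  case/eqP: c0; apply/rowP => k; have := p0 k; have := q0 k; rewrite !mxE.
  by case: (c 0 k) => x y /= -> ->.
have Im0 : complex.Im a = 0.
  have := Ssym p q; rewrite SRe SIm dotBl dotDr !dotZl !dotZr => e.
  apply/eqP/negPn/negP => a0.
  have {}e : complex.Im a * (g p p + g q q) = 0 by lra.
  move/eqP: e; rewrite mulf_eq0 (negPf a0) /= => /eqP e.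
  have := dot_ge0 g p; have := dot_ge0 g q => gq gp.
  by apply: pq0; apply: (dot_eq0 (g := g)); lra.
rewrite Im0 !scale0r ?subr0 ?addr0 in SRe SIm.
have [p0|p0] := eqVneq p 0; last by exists (complex.Re a), p.
exists (complex.Re a), q; split=> //.
by apply/eqP => q0; apply: pq0.
Qed.

End SymmetricEigenvalue.

(** * Skew families of endomorphisms *)

Section SkewFamily.
Variables (R : realType) (V Z : vectType R).
Variables (gV : {dot V for idfun}) (gZ : {dot Z for idfun}).
Variables (j : 'Hom(Z, 'End(V))) (br : V -> V -> Z).
Hypothesis j_skew : forall t x y, gV (j t x) y = - gV x (j t y).
Hypothesis j_faithful : forall x, (forall t, j t x = 0) -> x = 0.
Hypothesis brE : forall t x y, gZ t (br x y) = gV (j t x) y.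

Let e (i : 'I_(\dim (fullv : {vspace Z}))) : Z := (vbasis fullv)`_i.

Let j_zero x : (forall i, j (e i) x = 0) -> x = 0.
Proof.
move=> jx; apply: j_faithful => t; rewrite (coord_vbasis (memvf t)).
rewrite linear_sum sum_lfunE big1 // => i _.
by rewrite linearZ scale_lfunE [X in _ *: X]jx scaler0.
Qed.

(** The Casimir-like operator of the family, negative definite by skewness and
    faithfulness.  An arbitrary basis of [Z] serves, because only the
    invertibility of [K] matters. *)
Let K : 'End(V) := (\sum_i (j (e i) \o j (e i)))%VF.

Let KE x : K x = \sum_i j (e i) (j (e i) x).
Proof. by rewrite sum_lfunE; apply: eq_bigr => i _; rewrite comp_lfunE. Qed.

Let K_inj x : K x = 0 -> x = 0.
Proof.
move=> Kx; apply: j_zero => i.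
have : \sum_i gV (j (e i) x) (j (e i) x) = 0.
  transitivity (- gV (K x) x); last by rewrite Kx dot0l oppr0.
  rewrite KE dot_suml -sumrN; apply: eq_bigr => k _.
  by rewrite [in RHS]j_skew opprK.
move/eqP; rewrite psumr_eq0 => [|k _]; last exact: dot_ge0.
by move=> /allP/(_ i (mem_index_enum _))/eqP/dot_eq0.
Qed.

Let K_ker : lker K == 0%VS.
Proof.
rewrite -subv0; apply/subvP => x; rewrite memv_ker memv0 => /eqP.
by move/K_inj/eqP.
Qed.

(** The images of the [j t] span [V], since [K] is onto. *)
Lemma sum_of_images u : exists y : 'I_(\dim (fullv : {vspace Z})) -> V,
  u = \sum_i j (e i) (y i).
Proof.
exists (fun i => j (e i) ((K^-1)%VF u)); rewrite -KE.
by rewrite (lker0_lfunVK K_ker).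
Qed.

Lemma image_ind (P : V -> Prop) : P 0 -> (forall x y, P x -> P y -> P (x + y)) ->
  (forall t x, P (j t x)) -> forall u, P u.
Proof. by move=> P0 PD Pj u; have [y ->] := sum_of_images u; apply: big_ind. Qed.

(** Moving [K] through [A t] with the exchange rule gives
    [A t \o K = j t \o D] and [K \o A t = D \o j t] for the same
    [D = \sum_i A_i j_i], so that [S := K^-1 D] and [T := D K^-1] satisfy
    [A t = S j_t = j_t T].  The exchange rule makes [S] commute with [j_t] on the
    images of the [j_s], hence everywhere; then [j_t S = A t = j_t T] for all [t]
    and faithfulness gives [S = T]. *)
Lemma exchange_factor (A : 'Hom(Z, 'End(V))) :
  (forall t x y, gV (A t x) y = - gV x (A t y)) ->
  (forall t s x, A t (j s x) = j t (A s x)) ->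
  exists S : 'End(V), (forall x y, gV (S x) y = gV x (S y)) /\
    (forall t x, A t x = S (j t x) /\ A t x = j t (S x)).
Proof.
move=> A_skew AjE.
pose D : 'End(V) := (\sum_i (A (e i) \o j (e i)))%VF.
have DE x : D x = \sum_i A (e i) (j (e i) x).
  by rewrite sum_lfunE; apply: eq_bigr => i _; rewrite comp_lfunE.
have AK t x : A t (K x) = j t (D x).
  by rewrite KE DE !linear_sum; apply: eq_bigr => i _; apply: AjE.
have KA t x : K (A t x) = D (j t x).
  rewrite KE DE; apply: eq_bigr => i _.
  by rewrite -!AjE.
pose S := ((K^-1) \o D)%VF; pose T := (D \o (K^-1))%VF.
have AS t x : A t x = S (j t x).
  by rewrite comp_lfunE -KA lker0_lfunK.
have AT t x : A t x = j t (T x).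
  by rewrite comp_lfunE -AK lker0_lfunVK.
have jS t u : j t (S u) = S (j t u).
  elim/image_ind: u => [|x y IHx IHy|s x]; first by rewrite !linear0.
    by rewrite !linearD /= IHx IHy.
  by rewrite -!AS AjE.
have ST u : S u = T u.
  apply/eqP; rewrite -subr_eq0; apply/eqP; apply: j_faithful => t.
  by rewrite linearB /= jS -AS -AT subrr.
exists S; split=> [x y|t x]; last by rewrite -AS ST -AT.
elim/image_ind: x => [|x x' IHx IHx'|t x].
- by rewrite linear0 !dot0l.
- by rewrite linearD /= !dotDl IHx IHx'.
- by rewrite -AS A_skew AS -jS j_skew.
Qed.

(** The form that irreducibility takes on [V]: a [j]-stable [W] satisfying the
    second condition would generate an ideal complementary to another one. *)
Hypothesis indecomposable : forall W : {vspace V},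
  (forall t x, x \in W -> j t x \in W) ->
  (forall x b y, x \in W -> b \in W -> y \in orthov gV W -> j (br x b) y = 0) ->
  W = 0%VS \/ W = fullv.

(** An eigenspace [W] of [S] is stable under the [j t]; it remains to see that
    [w := j (br x b) y] vanishes for [x, b] in [W] and [y] orthogonal to [W].
    As [j] is skew and [W] stable, [w] is orthogonal to [W].  On the other hand,
    polarizing the symmetry condition at [x + y], where [br y b = 0], says that
    [S w = lam *: w], so [w] is also in [W]. *)
Lemma commuting_scalar (S : 'End(V)) :
  (forall x y, gV (S x) y = gV x (S y)) ->
  (forall t x, S (j t x) = j t (S x)) ->
  (forall x b c, gV (S (j (br x b) x)) c = gV (S (j (br x c) x)) b) ->
  exists lam, forall x, S x = lam *: x.
Proof.
move=> S_sym S_j S_br.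
have brDl x y b : br (x + y) b = br x b + br y b.
  apply: (dot_inj (g := gZ)) => t; rewrite dotDl ![gZ _ t]dotC !brE.
  by rewrite linearD dotDl.
have [V0|V0] := eqVneq (fullv : {vspace V}) 0%VS.
  exists 0 => x; rewrite scale0r.
  by apply/eqP; rewrite -memv0 -V0 memvf.
have [lam [u [u0 Su]]] := symmetric_eigenvector S_sym V0.
pose W := lker (S - lam *: \1)%VF.
have WP x : reflect (S x = lam *: x) (x \in W).
  rewrite memv_ker add_lfunE opp_lfunE scale_lfunE id_lfunE subr_eq0.
  exact: eqP.
have Wj t x : x \in W -> j t x \in W.
  by move=> /WP Sx; apply/WP; rewrite S_j Sx linearZ.
have [|W0|WT] := indecomposable Wj; last first.
- by exists lam => x; apply/WP; rewrite WT memvf.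
- by case/eqP: u0; apply/eqP; rewrite -memv0 -W0; apply/WP.
move=> x b y xW bW /mem_orthov yW.
set w := j (br x b) y.
have orthW t z : z \in W -> gV (j t y) z = 0.
  by move=> zW; rewrite j_skew yW ?oppr0 // Wj.
have bryb : br y b = 0.
  apply: (dot_inj (g := gZ)) => t.
  by rewrite dotC brE dot0l orthW.
suff wW : w \in W by apply: (dot_eq0 (g := gV)); rewrite orthW.
apply/WP/(dot_inj (g := gV)) => c.
(* The hypothesis is quadratic in its first argument: polarize it. *)
have := S_br (x + y) b c.
rewrite !brDl bryb addr0 !linearD /= !add_lfunE !linearD /= !dotDl.
have := S_br x b c; have := S_br y b c.
rewrite bryb !linear0 zero_lfunE !linear0 dot0l -/w.
have -> : gV (S (j (br x c) y)) b = 0.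
  by rewrite S_sym (WP _ bW) dotZr orthW // mulr0.
have -> : gV (S (j (br y c) x)) b = lam * gV w c.
  rewrite S_sym (WP _ bW) dotZr -brE dotC brE.
  by rewrite -[gV w c]brE dotC.
rewrite dotZl; lra.
Qed.

(** The factor [S] of [exchange_factor] commutes with the [j t], and the bracket
    condition on [A = S j] is the one that makes such an [S] a scalar. *)
Lemma exchange_scalar (A : 'Hom(Z, 'End(V))) :
  (forall t x y, gV (A t x) y = - gV x (A t y)) ->
  (forall t s x, A t (j s x) = j t (A s x)) ->
  (forall x b c, gV (A (br x b) x) c = gV (A (br x c) x) b) ->
  exists lam, forall t x, A t x = lam *: j t x.
Proof.
move=> A_skew AjE A_br.
have [S [S_sym AS]] := exchange_factor A_skew AjE.
have [||| lam Slam] := @commuting_scalar S; last first.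
- by exists lam => t x; rewrite (AS t x).1 Slam.
- by move=> x b c; rewrite -!(AS _ _).1.
- by move=> t x; rewrite -(AS _ _).1 (AS _ _).2.
- by [].
Qed.

End SkewFamily.

(** * The cubic form of a closed skew family *)

Section CubicForm.
Variables (R : realType) (V Z : vectType R).
Variables (gV : {dot V for idfun}) (gZ : {dot Z for idfun}).
Variables (j : 'Hom(Z, 'End(V))) (br : V -> V -> Z) (h : Z -> 'End(Z)).
Hypothesis j_skew : forall t x y, gV (j t x) y = - gV x (j t y).
Hypothesis brE : forall t x y, gZ t (br x y) = gV (j t x) y.
Hypothesis j_inj : lker j == 0%VS.
Hypothesis jh : forall s t, j (h s t) = lie (j s) (j t).
Hypothesis h_skew : forall s t r, gZ (h s t) r = - gZ t (h s r).

(** The canonical 3-form on the orthogonal sum of [V] and [Z], with its six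
    arguments grouped in pairs: the cyclic sum of [g (j t x) y] plus the cubic
    form [2 g (h r s) t] on [Z].  The factor 2 is the one that the Killing
    equation imposes. *)
Definition cubic_form (x1 : V) (t1 : Z) (x2 : V) (t2 : Z) (x3 : V) (t3 : Z) : R :=
  gV (j t1 x2) x3 + gV (j t2 x3) x1 + gV (j t3 x1) x2 + 2 * gZ (h t1 t2) t3.

Let hC s t : h s t = - h t s.
Proof. by have /lker0P jI := j_inj; apply: jI; rewrite linearN /= !jh lieC. Qed.

Let j_flip t x y : gV (j t x) y = - gV (j t y) x.
Proof. by rewrite j_skew dotC. Qed.

Lemma cubic_form_linear c x x' t t' x2 t2 x3 t3 :
  cubic_form (c *: x + x') (c *: t + t') x2 t2 x3 t3 =
  c * cubic_form x t x2 t2 x3 t3 + cubic_form x' t' x2 t2 x3 t3.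
Proof.
have jP q q' u : j (c *: q + q') u = c *: j q u + j q' u.
  by rewrite linearP add_lfunE scale_lfunE.
rewrite /cubic_form !(hC _ t2) jP ![j t3 _]linearP [h t2 _]linearP /=.
rewrite !dotNl !dotPl dotPr; ring.
Qed.

Lemma cubic_form_swap12 x1 t1 x2 t2 x3 t3 :
  cubic_form x1 t1 x2 t2 x3 t3 = - cubic_form x2 t2 x1 t1 x3 t3.
Proof.
rewrite /cubic_form (j_flip t1 x2) (j_flip t2 x3) (j_flip t3 x1) (hC t1) dotNl.
ring.
Qed.

Lemma cubic_form_swap23 x1 t1 x2 t2 x3 t3 :
  cubic_form x1 t1 x2 t2 x3 t3 = - cubic_form x1 t1 x3 t3 x2 t2.
Proof.
rewrite /cubic_form (j_flip t1 x2) (j_flip t2 x3) (j_flip t3 x1) h_skew.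
rewrite (dotC _ t2); ring.
Qed.

(** Here [D x t x1 s] and [2^-1 *: br x x1] are the components in [V] and [Z] of
    the covariant derivative of [(x1, s)] along [(x, t)].  Once [h] and [br] have
    been eliminated, everything is a combination of terms
    [g (j _ _) (j _ _)], which cancel by symmetry of [g]. *)
Lemma cubic_form_killing x t x1 s x2 r :
  let D x t x1 s := - 2^-1 *: (j t x1 + j s x) in
  cubic_form (D x t x t) (2^-1 *: br x x) x1 s x2 r
  + cubic_form x t (D x t x1 s) (2^-1 *: br x x1) x2 r
  + cubic_form x t x1 s (D x t x2 r) (2^-1 *: br x x2) = 0.
Proof.
rewrite /cubic_form /=.
have brC y w : br y w = - br w y.
  by apply: (dot_inj (g := gZ)) => q; rewrite dotNl !(dotC _ (br _ _)) !brE j_flip.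
have -> : br x x = 0.
  by apply: (dot_inj (g := gZ)) => q; rewrite dot0l dotC brE; have := j_flip q x x; lra.
have jZ q u : j (2^-1 *: q) u = 2^-1 *: j q u by rewrite linearZ scale_lfunE.
have jS q u u' : j q (- 2^-1 *: (u + u')) = - 2^-1 *: (j q u + j q u').
  by rewrite linearZ linearD.
have j0 u : j 0 u = 0 by rewrite linear0 zero_lfunE.
have h0 q : h 0 q = 0 by rewrite hC linear0 oppr0.
have hZ q q' : h q (2^-1 *: q') = 2^-1 *: h q q' by rewrite linearZ.
rewrite !scaler0 !jZ !jS !j0 h0 !hZ !dotZl !dotZr !dotDl !dotDr !dot0l.
have jj q q' u u' : gV (j q (j q' u)) u' = - gV (j q' u) (j q u').
  exact: j_skew.
have hbr q q' u u' : gZ (h q q') (br u u') =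
    gV (j q u) (j q' u') - gV (j q' u) (j q u').
  by rewrite brE jh /= add_lfunE opp_lfunE !comp_lfunE dotBl !jj; ring.
(* Move the bracket out of [h], so that [hbr] applies to every [h] term. *)
rewrite (h_skew t (br x x1)) (dotC _ (br x x1)) !hbr !jj.
have jb u u' w w' : gV (j (br u u') w) w' = gZ (br u u') (br w w').
  by rewrite brE.
rewrite !jb (brC x2 x) dotNr (dotC _ (br x x2)).
rewrite (dotC gV (j s x2)) (dotC gV (j t x2)) (dotC gV (j t x1) (j r x)).
lra.
Qed.

End CubicForm.

(** * Killing forms of degree three on a Lie algebra *)

Section ThreeForms.
Variables (R : realType).

(** Skewness under the two transpositions stands for the vanishing on repeated
    arguments, which is equivalent over the reals, and then linearity in the
    first argument is enough. *)
Definition alt3 (U : vectType R) (a : U -> U -> U -> R) : Prop :=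
  [/\ forall y z, scalar (fun x => a x y z),
      forall x y z, a x y z = - a y x z
    & forall x y z, a x y z = - a x z y].

Section Alt3.
Variables (U : vectType R) (a : U -> U -> U -> R).
Hypothesis aA : alt3 a.

Lemma alt3_12 x y z : a x y z = - a y x z. Proof. by case: aA. Qed.
Lemma alt3_23 x y z : a x y z = - a x z y. Proof. by case: aA. Qed.
Lemma alt3_13 x y z : a x y z = - a z y x.
Proof. by rewrite alt3_12 alt3_23 (alt3_12 y) opprK. Qed.

Lemma alt3_12_0 x z : a x x z = 0. Proof. by have := alt3_12 x x z; lra. Qed.
Lemma alt3_23_0 x z : a z x x = 0. Proof. by have := alt3_23 z x x; lra. Qed.
Lemma alt3_13_0 x z : a x z x = 0. Proof. by have := alt3_13 x z x; lra. Qed.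

Lemma alt3_lin1 c x x' y z : a (c *: x + x') y z = c * a x y z + a x' y z.
Proof. by case: aA => aL _ _; apply: aL. Qed.

Lemma alt3D1 x x' y z : a (x + x') y z = a x y z + a x' y z.
Proof. by rewrite -[x]scale1r alt3_lin1 mul1r scale1r. Qed.
Lemma alt3_01 y z : a 0 y z = 0.
Proof. by have := alt3D1 0 0 y z; rewrite addr0; lra. Qed.
Lemma alt3Z1 c x y z : a (c *: x) y z = c * a x y z.
Proof. by rewrite -[c *: x]addr0 alt3_lin1 alt3_01 addr0. Qed.
Lemma alt3N1 x y z : a (- x) y z = - a x y z.
Proof. by rewrite -scaleN1r alt3Z1 mulN1r. Qed.

Lemma alt3D2 x x' y z : a y (x + x') z = a y x z + a y x' z.
Proof. by rewrite !(alt3_12 y) alt3D1 opprD. Qed.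
Lemma alt3_02 y z : a y 0 z = 0.
Proof. by rewrite alt3_12 alt3_01 oppr0. Qed.
Lemma alt3Z2 c x y z : a y (c *: x) z = c * a y x z.
Proof. by rewrite !(alt3_12 y) alt3Z1 mulrN. Qed.
Lemma alt3N2 x y z : a y (- x) z = - a y x z.
Proof. by rewrite !(alt3_12 y) alt3N1. Qed.

Lemma alt3D3 x x' y z : a y z (x + x') = a y z x + a y z x'.
Proof. by rewrite !(alt3_13 y) alt3D1 opprD. Qed.
Lemma alt3_03 y z : a y z 0 = 0.
Proof. by rewrite alt3_13 alt3_01 oppr0. Qed.
Lemma alt3Z3 c x y z : a y z (c *: x) = c * a y z x.
Proof. by rewrite !(alt3_13 y) alt3Z1 mulrN. Qed.
Lemma alt3N3 x y z : a y z (- x) = - a y z x.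
Proof. by rewrite !(alt3_13 y) alt3N1. Qed.

Definition alt3E := (alt3D1, alt3D2, alt3D3, alt3Z1, alt3Z2, alt3Z3,
  alt3N1, alt3N2, alt3N3, alt3_01, alt3_02, alt3_03).

End Alt3.

Variable n : lieAlgType R.

Definition o30 : 'I_3 := Ordinal (isT : 0 < 3)%N.
Definition o31 : 'I_3 := Ordinal (isT : 1 < 3)%N.
Definition o32 : 'I_3 := Ordinal (isT : 2 < 3)%N.

Definition tri (x y z : n) : 'I_3 -> n := fun i => nth x [:: x; y; z] i.

Definition form3 (a : n -> n -> n -> R) : kform n 3 :=
  fun x => a (x o30) (x o31) (x o32).

Definition fun3 (al : kform n 3) : n -> n -> n -> R :=
  fun x y z => al (tri x y z).

Lemma ord3P (P : 'I_3 -> Prop) : P o30 -> P o31 -> P o32 -> forall i, P i.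
Proof.
move=> P0 P1 P2 [[|[|[|//]]] lti].
- by rewrite (_ : Ordinal lti = o30) //; apply: val_inj.
- by rewrite (_ : Ordinal lti = o31) //; apply: val_inj.
- by rewrite (_ : Ordinal lti = o32) //; apply: val_inj.
Qed.

Lemma fun3K : cancel fun3 form3.
Proof.
by move=> al; apply/funext => x; congr al; apply/funext; apply: ord3P.
Qed.

Lemma form3K : cancel form3 fun3.
Proof. by []. Qed.

Lemma alternating_alt3 (al : kform n 3) : alternating al -> alt3 (fun3 al).
Proof.
move=> [lin alt0].
have triE i w x y z : (fun l => if l == i then w else tri x y z l) =
    match val i with
    | 0%N => tri w y z | 1%N => tri x w z | _ => tri x y w end.
  by apply/funext => l; elim/ord3P: i; elim/ord3P: l.
have lin1 y z : scalar (fun x => fun3 al x y z).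
  by move=> c x x'; have := lin (tri x y z) o30 c x x'; rewrite !triE.
have lin2 y z : scalar (fun x => fun3 al y x z).
  by move=> c x x'; have := lin (tri y x z) o31 c x x'; rewrite !triE.
have lin3 y z : scalar (fun x => fun3 al y z x).
  by move=> c x x'; have := lin (tri y z x) o32 c x x'; rewrite !triE.
have alt1 x z : fun3 al x x z = 0 by apply: (alt0 _ o30 o31).
have alt2 x z : fun3 al z x x = 0 by apply: (alt0 _ o31 o32).
split=> // x y z.
  have := alt1 (1 *: x + y) z; rewrite lin1 !lin2 !alt1; lra.
have := alt2 (1 *: y + z) x; rewrite lin2 !lin3 !alt2; lra.
Qed.

Lemma alt3_alternating a : alt3 a -> alternating (form3 a).
Proof.
move=> aA; split=> [x i|x i l].
  move=> c u v; rewrite /form3; elim/ord3P: i => /=.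
  - by rewrite !(alt3E aA).
  - by rewrite !(alt3E aA).
  - by rewrite !(alt3E aA).
rewrite /form3; elim/ord3P: i; elim/ord3P: l => //= _ ->.
- exact: alt3_12_0.
- exact: alt3_13_0.
- exact: alt3_12_0.
- exact: alt3_23_0.
- exact: alt3_13_0.
- exact: alt3_23_0.
Qed.

Variable nabla : 'Hom(n, 'End(n)).

Lemma cov_deriv3 (a : n -> n -> n -> R) y u v w :
  cov_deriv nabla y (form3 a) (tri u v w) =
  - (a (nabla y u) v w + a u (nabla y v) w + a u v (nabla y w)).
Proof. by rewrite /cov_deriv !big_ord_recl big_ord0 /form3 /= addr0 addrA. Qed.

Let o4 i (lti : (i < 4)%N) : 'I_4 := Ordinal lti.

(* Turns the sums over pairs of indices in the differential into explicit
   ones, with the omission of two indices computed. *)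
Let enum4 : enum 'I_4 =
  [:: @o4 0 isT; @o4 1 isT; @o4 2 isT; @o4 3 isT].
Proof. by apply: (inj_map val_inj); rewrite val_enum_ord. Qed.

Lemma contraction_lie_diff3 (a : n -> n -> n -> R) y u v w :
  contraction y (lie_diff (form3 a)) (tri u v w) =
  - a (lie y u) v w + a (lie y v) u w - a (lie y w) u v
  - a (lie u v) y w + a (lie u w) y v - a (lie v w) y u.
Proof.
rewrite /contraction; set x := fun i => _.
have x0 : x (@o4 0 isT) = y.
  by rewrite /x (_ : o4 _ = ord0) ?unlift_none //; apply: val_inj.
have x1 : x (@o4 1 isT) = u.
  by rewrite /x (_ : o4 _ = lift ord0 o30) ?liftK //; apply: val_inj.
have x2 : x (@o4 2 isT) = v.
  by rewrite /x (_ : o4 _ = lift ord0 o31) ?liftK //; apply: val_inj.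
have x3 : x (@o4 3 isT) = w.
  by rewrite /x (_ : o4 _ = lift ord0 o32) ?liftK //; apply: val_inj.
have ie : index_enum 'I_4 = enum 'I_4 by rewrite enumT.
rewrite /lie_diff ie enum4 !big_cons !big_nil /=.
by rewrite /form3 /= x0 x1 x2 x3 /= !exprS !expr0 /=; ring.
Qed.

(** The covariant derivative of the form, with the differentiated entry moved
    to the front, so that the entries never need to be permuted again. *)
Let B (a : n -> n -> n -> R) y b c e :=
  - (a (nabla y b) c e - a (nabla y c) b e + a (nabla y e) b c).

Definition killing3 (a : n -> n -> n -> R) : Prop := forall y b c,
  a (nabla y y) b c + a y (nabla y b) c + a y b (nabla y c) = 0.

Lemma killing3_polar (a : n -> n -> n -> R) p q b c : alt3 a -> killing3 a ->
  a (nabla p q) b c + a (nabla q p) b c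
  + a p (nabla q b) c + a q (nabla p b) c
  + a p b (nabla q c) + a q b (nabla p c) = 0.
Proof.
move=> aA aK; have := aK (p + q) b c; have := aK p b c; have := aK q b c.
rewrite ![nabla (p + q)]linearD !add_lfunE !linearD /= !(alt3E aA); lra.
Qed.

(** Since [nabla] is torsion free, the differential of [a] is the alternating
    sum [dE] of covariant derivatives.  If [nabla a] is totally skew, the four
    terms of that sum are equal; conversely, the Killing equation makes
    [nabla_y a] vanish on [y], because the differential does. *)
Lemma killing_form3 (al : kform n 3) :
  (forall x y, nabla x y - nabla y x = lie x y) ->
  killing_form nabla al <-> alt3 (fun3 al) /\ killing3 (fun3 al).
Proof.
move=> tor; set a := fun3 al.
have al_a : al = form3 a by rewrite fun3K.
have triE x : x = tri (x o30) (x o31) (x o32).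
  by apply/funext; apply: ord3P.
have BE : alt3 a -> forall y b c e,
    a (nabla y b) c e + a b (nabla y c) e + a b c (nabla y e) = - B a y b c e.
  move=> aA y b c e; rewrite /B (alt3_12 aA b (nabla y c)).
  by rewrite (alt3_13 aA b c) (alt3_23 aA (nabla y e) c b); ring.
have dE : alt3 a -> forall y u v w,
    contraction y (lie_diff (form3 a)) (tri u v w) =
    B a y u v w - B a u y v w + B a v y u w - B a w y u v.
  by move=> aA y u v w; rewrite contraction_lie_diff3 -!tor !(alt3E aA) /B; ring.
split=> [[alA alK]|[aA aK]].
  have aA : alt3 a by apply: alternating_alt3.
  have B0 b y c : B a b y y c = 0 by rewrite /B (alt3_23_0 aA); ring.
  split=> // y b c; have := alK y (tri y b c).
  rewrite al_a cov_deriv3 BE // dE // !B0.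
  by rewrite opprK subrr add0r subrr mulr0 => ->; rewrite oppr0.
split=> [|y x]; first by rewrite al_a; apply: alt3_alternating.
rewrite (triE x) al_a cov_deriv3 BE // dE //.
set u := x o30; set v := x o31; set w := x o32.
have pol p q b c : B a p q b c + B a q p b c = 0.
  have := killing3_polar p q b c aA aK.
  have := BE aA p q b c; have := BE aA q p b c; lra.
have yv : B a y v u w = - B a y u v w.
  by rewrite /B (alt3_23 aA _ v u); ring.
have yw : B a y w u v = B a y u v w.
  by rewrite /B (alt3_23 aA _ w v) (alt3_23 aA _ w u); ring.
have := pol y u v w; have := pol y v u w; have := pol y w u v.
rewrite yv yw; lra.
Qed.

End ThreeForms.

(** * Metric 2-step nilpotent Lie algebras *)

Section TwoStep.
Variables (R : realType) (n : lieAlgType R) (g : {dot n for idfun}).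

Local Notation z := (center n).
Local Notation v := (orthov g z).
Local Notation Z := (subvs_of z).
Local Notation V := (subvs_of v).
Local Notation gZ := (subdot g z : {dot Z for idfun}).
Local Notation gV := (subdot g v : {dot V for idfun}).

Lemma subdot_z (s t : Z) : gZ s t = g (vsval s) (vsval t). Proof. by []. Qed.
Lemma subdot_v (x y : V) : gV x y = g (vsval x) (vsval y). Proof. by []. Qed.

Lemma dot_vz (x : V) (t : Z) : g (vsval x) (vsval t) = 0.
Proof. by apply: (mem_orthov g _ _).1 (subvsP x) _ (subvsP t). Qed.

Lemma dot_zv (x : V) (t : Z) : g (vsval t) (vsval x) = 0.
Proof. by rewrite dotC dot_vz. Qed.

Let vz0 : (v :&: z)%VS = 0%VS.
Proof.
apply/eqP; rewrite -subv0; apply/subvP => x; rewrite memv_cap => /andP[xv xz].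
by rewrite memv0; apply/eqP/(dot_eq0 (g := g))/((mem_orthov g _ _).1 xv).
Qed.

(** The components in [v] and [z].  The projections along a complement chosen by
    [vsproj] itself need not be orthogonal, hence [daddv_pi]. *)
Definition vproj : 'Hom(n, V) := linfun (vsproj v \o daddv_pi v z).
Definition zproj : 'Hom(n, Z) := linfun (vsproj z \o daddv_pi z v).

Lemma vzE u : u = vsval (vproj u) + vsval (zproj u).
Proof.
rewrite !lfunE /= !vsprojK ?memv_pi //.
rewrite daddv_pi_add //.
have [w [w' [wz w'v ->]]] := orthov_decomp g z u.
by rewrite addrC memv_add.
Qed.

Lemma vprojD (x : V) (t : Z) : vproj (vsval x + vsval t) = x.
Proof.
apply: subvs_inj; apply: (dot_inj (g := g)) => u.
rewrite (vzE u); set y := vproj u; set s := zproj u.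
have := vzE (vsval x + vsval t); set x' := vproj _; set t' := zproj _.
move=> /(congr1 (fun w => g w (vsval y))).
by rewrite !dotDl !dotDr !dot_zv !dot_vz !addr0 => ->.
Qed.

Lemma zprojD (x : V) (t : Z) : zproj (vsval x + vsval t) = t.
Proof.
have := vzE (vsval x + vsval t); rewrite vprojD => /addrI e.
exact/esym/subvs_inj.
Qed.

Lemma vproj_v (x : V) : vproj (vsval x) = x.
Proof. by rewrite -[RHS](vprojD x 0) linear0 addr0. Qed.
Lemma vproj_z (t : Z) : vproj (vsval t) = 0.
Proof. by rewrite -[RHS](vprojD 0 t) linear0 add0r. Qed.
Lemma zproj_v (x : V) : zproj (vsval x) = 0.
Proof. by rewrite -[RHS](zprojD x 0) linear0 addr0. Qed.
Lemma zproj_z (t : Z) : zproj (vsval t) = t.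
Proof. by rewrite -[RHS](zprojD 0 t) linear0 add0r. Qed.

Hypothesis two_step : two_step_nilpotent n.

Lemma lie_in_center x y : lie x y \in z.
Proof. by case: two_step => _ /brackvP; apply; rewrite memvf. Qed.

Lemma liez x (t : Z) : lie x (vsval t) = 0.
Proof. by rewrite lieC (centerP _ (subvsP t)) oppr0. Qed.
Lemma lie_z x (t : Z) : lie (vsval t) x = 0.
Proof. exact: (centerP _ (subvsP t)). Qed.

Definition vbracket (x y : V) : Z := vsproj z (lie (vsval x) (vsval y)).

Lemma vbracketE x y : vsval (vbracket x y) = lie (vsval x) (vsval y).
Proof. by rewrite vsprojK // lie_in_center. Qed.

Lemma lie_vproj x y : lie x y = vsval (vbracket (vproj x) (vproj y)).
Proof.
rewrite vbracketE {1}(vzE x) {1}(vzE y) linearDl /= !linearD /=.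
by rewrite !liez lie_z !addr0.
Qed.

Variable j : 'Hom(Z, 'End(V)).
Hypothesis jP : is_jmap g j.

Lemma vbracket_jmap t x y : gZ t (vbracket x y) = gV (j t x) y.
Proof. by rewrite subdot_z vbracketE -jP. Qed.

Lemma jmap_skew t x y : gV (j t x) y = - gV x (j t y).
Proof. exact: jmap_so jP x y. Qed.

Lemma vbracketC x y : vbracket x y = - vbracket y x.
Proof. by apply: subvs_inj; rewrite linearN /= !vbracketE lieC. Qed.

Lemma vbracketxx x : vbracket x x = 0.
Proof. by apply: subvs_inj; rewrite vbracketE liexx linear0. Qed.
Lemma vbracketv0 x : vbracket x 0 = 0.
Proof. by apply: subvs_inj; rewrite vbracketE !linear0. Qed.
Lemma vbracket0v x : vbracket 0 x = 0.
Proof. by rewrite vbracketC vbracketv0 oppr0. Qed.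

(** If every [j t] kills [x], then [x] is central, hence orthogonal to itself. *)
Lemma jmap_faithful x : (forall t, j t x = 0) -> x = 0.
Proof.
move=> jx; apply: subvs_inj; rewrite linear0; apply: (dot_eq0 (g := g)).
apply: (mem_orthov g _ _).1 (subvsP x) _ _; apply/centerP => y.
rewrite lie_vproj vproj_v [vbracket _ _](_ : _ = 0) ?linear0 //.
by apply: (dot_inj (g := gZ)) => t; rewrite dotC vbracket_jmap jx !dot0l.
Qed.

Hypothesis irr : irreducible g.

(** If [j t = 0], then [t] is orthogonal to all brackets, so the line of [t] and
    its orthogonal complement are both ideals. *)
Lemma jmap_inj : lker j == 0%VS.
Proof.
rewrite -subv0; apply/subvP => t; rewrite memv_ker memv0 => /eqP jt.
apply/negPn/negP => t0.
pose A := <[vsval t]>%VS.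
have tl x y : g (vsval t) (lie x y) = 0.
  have := vbracket_jmap t (vproj x) (vproj y).
  by rewrite jt zero_lfunE dot0l subdot_z -lie_vproj.
have At : vsval t \in A by apply: memv_line.
have AB : (A <= orthov g (orthov g A))%VS.
  apply/subvP => a aA; apply/mem_orthov => b /mem_orthov bA.
  by rewrite dotC bA.
apply: irr; exists A, (orthov g A); split=> //.
- apply: contra_neq t0 => A0; apply: subvs_inj; rewrite linear0.
  by apply/eqP; rewrite -memv0 -A0.
- apply/eqP => B0; case: two_step => ab _; apply: ab => x y.
  apply/eqP; rewrite -memv0 -B0; apply/mem_orthov => a /vlineP[c ->].
  by rewrite dotZr dotC tl mulr0.
- by apply/brackvP => x y _ /vlineP[c ->]; rewrite linearZ /= liez scaler0 mem0v.
- apply/brackvP => x y _ _; apply/mem_orthov => a /vlineP[c ->].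
  by rewrite dotZr dotC tl mulr0.
- split=> //; apply/eqP; rewrite eqEsubv subvf; apply/subvP => u _.
  by have [w [w' [wA wB ->]]] := orthov_decomp g A u; apply: memv_add.
Qed.

(** The ideals are [A := W + [W, W]] and its orthogonal complement [B].
    Stability of [W] makes [W] commute with its complement in [v], which gives
    that [A] is an ideal; the second condition says that brackets with an element
    of [B] are orthogonal to [[W, W]], which gives the same for [B]. *)
Lemma jmap_indecomposable (W : {vspace V}) :
  (forall t x, x \in W -> j t x \in W) ->
  (forall x b y, x \in W -> b \in W -> y \in orthov gV W ->
     j (vbracket x b) y = 0) ->
  W = 0%VS \/ W = fullv.
Proof.
move=> Wj Wbr.
pose Wn := (linfun vsval @: W)%VS : {vspace n}.
have WnP w : w \in Wn -> exists2 x, x \in W & w = vsval x.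
  by move=> /memv_imgP[x xW ->]; exists x => //; rewrite lfunE.
have Wn_mem x : x \in W -> vsval x \in Wn.
  by move=> xW; apply/memv_imgP; exists x => //; rewrite lfunE.
pose A := (Wn + brackv Wn Wn)%VS; pose B := orthov g A.
have orthW x y : x \in W -> y \in orthov gV W -> vbracket x y = 0.
  move=> xW /mem_orthov yW; apply: (dot_inj (g := gZ)) => t.
  by rewrite dot0l dotC vbracket_jmap dotC yW ?Wj.
have brz : (brackv Wn Wn <= z)%VS by apply/brackvP => x y _ _; apply: lie_in_center.
have Aid : lie_ideal A.
  apply/brackvP => u a _ /memv_addP[_ /WnP[x xW ->] [s /(subvP brz) sz ->]].
  rewrite linearD /= [lie u s]lieC (centerP _ sz) oppr0 addr0.
  rewrite lie_vproj vproj_v.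
  have [w [w' [wW w'W ->]]] := orthov_decomp gV W (vproj u).
  rewrite vbracketE linearD /= linearDl /= -!vbracketE.
  rewrite [vbracket w' x]vbracketC (orthW x w') // oppr0 linear0 addr0 vbracketE.
  apply: (subvP (addvSr _ _)); move/brackvP: (subvv (brackv Wn Wn)).
  by apply; apply: Wn_mem.
have Bid : lie_ideal B.
  apply/brackvP => u b _ /mem_orthov bB; apply/mem_orthov => a.
  move=> /memv_addP[_ /WnP[x xW ->] [s sbr ->]].
  rewrite dotDr lie_vproj dot_zv add0r.
  have bW : vproj b \in orthov gV W.
    apply/mem_orthov => w wW; rewrite subdot_v.
    have := bB _ (subvP (addvSl Wn (brackv Wn Wn)) _ (Wn_mem _ wW)).
    by rewrite {1}(vzE b) dotDl dot_zv addr0.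
  set l := vsval _.
  suff /subvP/(_ _ sbr)/mem_orthov : (brackv Wn Wn <= orthov g <[l]>)%VS.
    by move=> /(_ l (memv_line _)); rewrite dotC.
  apply/brackvP => _ _ /WnP[x1 x1W ->] /WnP[x2 x2W ->].
  apply/mem_orthov => _ /vlineP[c ->].
  rewrite dotZr -vbracketE -subdot_z vbracket_jmap jmap_skew Wbr //.
  by rewrite dot0r oppr0 mulr0.
have [W0|W0] := eqVneq W 0%VS; first by left.
right; apply: (orthov_eq0 (g := gV)) => y yW.
apply/eqP/negPn/negP => y0; apply: irr; exists A, B; split=> //.
- apply: contra_neq W0 => A0; apply/eqP; rewrite -subv0; apply/subvP => x xW.
  have := subvP (addvSl Wn (brackv Wn Wn)) _ (Wn_mem _ xW).
  rewrite -/A A0 memv0 => /eqP x0; rewrite memv0.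
  by apply/eqP/subvs_inj; rewrite x0 linear0.
- apply: contra_neq y0 => B0; apply: subvs_inj; rewrite linear0.
  apply/eqP; rewrite -memv0 -B0; apply/mem_orthov => a.
  move=> /memv_addP[_ /WnP[x xW ->] [s /(subvP brz) sz ->]].
  rewrite dotDr -subdot_v ((mem_orthov gV _ _).1 yW) // add0r.
  exact: (mem_orthov g _ _).1 (subvsP y) _ sz.
split; last first.
  apply/eqP; rewrite eqEsubv subvf; apply/subvP => u _.
  by have [w [w' [wA wB ->]]] := orthov_decomp g A u; apply: memv_add.
by apply/subvP => a aA; apply/mem_orthov => b /mem_orthov bA; rewrite dotC bA.
Qed.

Variable nabla : 'Hom(n, 'End(n)).
Hypothesis lc : levi_civita g nabla.

(** The usual Koszul formula, the derivatives of the constant functions [g x y]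
    being zero. *)
Lemma koszul x y w :
  g (nabla x y) w = 2^-1 * (g (lie x y) w - g (lie y w) x + g (lie w x) y).
Proof.
case: lc => tor met.
rewrite -!tor !dotBl.
have := met x y w; have := met y x w; have := met w x y.
rewrite ?(dotC g _ (nabla _ _)); lra.
Qed.

Lemma koszul_vproj x y w : g (nabla x y) w =
  2^-1 * (gZ (vbracket (vproj x) (vproj y)) (zproj w)
          - gV (j (zproj x) (vproj y) + j (zproj y) (vproj x)) (vproj w)).
Proof.
have dotz (u : n) (t : Z) : g (vsval t) u = gZ t (zproj u).
  by rewrite (vzE u) dotDr dot_zv add0r zprojD.
rewrite koszul !lie_vproj !dotz dotDl -!vbracket_jmap.
rewrite [vbracket (vproj w) _]vbracketC dotNl.
rewrite [gZ (vbracket (vproj y) _) _]dotC [gZ (vbracket (vproj x) _) (zproj y)]dotC.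
ring.
Qed.

Lemma zproj_nabla x y :
  zproj (nabla x y) = 2^-1 *: vbracket (vproj x) (vproj y).
Proof.
apply: (dot_inj (g := gZ)) => t; have := koszul_vproj x y (vsval t).
rewrite vproj_z dot0r subr0 zproj_z dotZl => <-.
by rewrite [in RHS](vzE (nabla x y)) dotDl dot_vz add0r.
Qed.

Lemma vproj_nabla x y : vproj (nabla x y) =
  - 2^-1 *: (j (zproj x) (vproj y) + j (zproj y) (vproj x)).
Proof.
apply: (dot_inj (g := gV)) => t; have := koszul_vproj x y (vsval t).
rewrite zproj_v dot0r sub0r vproj_v dotZl mulNr -mulrN => <-.
by rewrite [in RHS](vzE (nabla x y)) dotDl dot_zv addr0.
Qed.

Lemma nabla_vv (x y : V) :
  nabla (vsval x) (vsval y) = 2^-1 *: vsval (vbracket x y).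
Proof.
rewrite [LHS]vzE vproj_nabla zproj_nabla !vproj_v !zproj_v.
by rewrite !linear0 !zero_lfunE addr0 scaler0 linear0 add0r linearZ.
Qed.

Lemma nabla_vz (x : V) (t : Z) :
  nabla (vsval x) (vsval t) = - 2^-1 *: vsval (j t x).
Proof.
rewrite [LHS]vzE vproj_nabla zproj_nabla vproj_v vproj_z zproj_v zproj_z.
by rewrite vbracketv0 !linear0 add0r addr0 linearZ.
Qed.

Lemma nabla_zv (x : V) (t : Z) :
  nabla (vsval t) (vsval x) = - 2^-1 *: vsval (j t x).
Proof.
rewrite [LHS]vzE vproj_nabla zproj_nabla vproj_v vproj_z zproj_v zproj_z.
by rewrite vbracket0v !linear0 !addr0 linearZ.
Qed.

Lemma nabla_zz (s t : Z) : nabla (vsval s) (vsval t) = 0.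
Proof.
rewrite [LHS]vzE vproj_nabla zproj_nabla !vproj_z vbracket0v.
by rewrite !linear0 !addr0 !linear0.
Qed.

(** * Killing 3-forms and the canonical form *)

Section KillingThreeForm.
Variable a : n -> n -> n -> R.
Hypotheses (aA : alt3 a) (aK : killing3 nabla a).

(** [F r y s t = a (j r y) s t] is skew in [r, s, t], so that the Killing
    identity, polarized at [(y, r)], reads [- 2 F r y s t = 0]. *)
Lemma killing3_vzz (x : V) (s t : Z) : a (vsval x) (vsval s) (vsval t) = 0.
Proof.
pose F (r : Z) (y : V) (s t : Z) := a (vsval (j r y)) (vsval s) (vsval t).
have F0 r y c : F r y r c = 0.
  have := aK (vsval r) (vsval y) (vsval c).
  rewrite nabla_zz nabla_zv nabla_zz !(alt3E aA) (alt3_12 aA) /F; lra.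
have F12 r y b c : F r y b c = - F b y r c.
  have := F0 (r + b) y c; have := F0 r y c; have := F0 b y c.
  rewrite /F !(linearD j) !add_lfunE !linearD /= !(alt3E aA); lra.
have F23 r y b c : F r y b c = - F r y c b by rewrite /F (alt3_23 aA).
elim/(image_ind jmap_skew jmap_faithful): x => [|x y IHx IHy|r y].
- by rewrite linear0 (alt3E aA).
- by rewrite linearD (alt3E aA) IHx IHy addr0.
have := killing3_polar (vsval y) (vsval r) (vsval s) (vsval t) aA aK.
rewrite nabla_vz nabla_zv !nabla_zz !nabla_vz !(alt3E aA).
rewrite (alt3_12 aA (vsval r) (vsval (j s y))).
rewrite (alt3_13 aA (vsval r) _ (vsval (j t y))) (alt3_23 aA (vsval (j t y))).
have := F12 s y r t; have := F12 t y r s; have := F23 r y s t; rewrite /F; lra.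
Qed.

(** As in the previous lemma, with [G r x y w = a (j r x) y w], which is skew in
    [x, y, w]; the terms with two arguments in [z] vanish already. *)
Lemma killing3_vvv (x y w : V) : a (vsval x) (vsval y) (vsval w) = 0.
Proof.
pose G (r : Z) (x y w : V) := a (vsval (j r x)) (vsval y) (vsval w).
have G0 r u b : G r u u b = 0.
  have := aK (vsval u) (vsval b) (vsval r).
  rewrite !nabla_vv nabla_vz vbracketxx !linear0 !(alt3E aA) killing3_vzz.
  rewrite (alt3_13 aA (vsval u)) (alt3_23 aA (vsval (j r u))) /G; lra.
have G12 r u u' b : G r u u' b = - G r u' u b.
  have := G0 r (u + u') b; have := G0 r u b; have := G0 r u' b.
  rewrite /G !linearD /= !(alt3E aA); lra.
have G23 r u u' b : G r u u' b = - G r u b u' by rewrite /G (alt3_23 aA).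
elim/(image_ind jmap_skew jmap_faithful): x => [|x x' IHx IHx'|r x].
- by rewrite linear0 (alt3E aA).
- by rewrite linearD (alt3E aA) IHx IHx' addr0.
have := killing3_polar (vsval x) (vsval r) (vsval y) (vsval w) aA aK.
rewrite nabla_vz !nabla_zv !nabla_vv !(alt3E aA).
rewrite (alt3_12 aA (vsval x) (vsval (j r y))).
rewrite (alt3_13 aA (vsval x) _ (vsval (j r w))) (alt3_23 aA (vsval (j r w))).
rewrite (alt3_13 aA (vsval r) _ (vsval w)) (alt3_12 aA (vsval r) (vsval y)).
rewrite (alt3_23 aA (vsval y)) !killing3_vzz.
have := G12 r x y w; have := G23 r x y w; have := G23 r y x w; have := G12 r x w y.
have := G23 r w x y; rewrite /G; lra.
Qed.

(** With [P c t x b = g (A_c (j_t x)) b] and [W c t x b = g (j (w c t) x) b],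
    the four versions of [main] under exchanging [c, t] and [x, b] are linear
    equations that are solved by [PE], whose first half is the exchange rule
    [A_c j_t = j_c A_t] and whose second half expresses [j (w c t)] as twice a
    commutator.  The Killing identity on three arguments in [v] is the bracket
    condition of [exchange_scalar]. *)
Lemma killing3_scalar : exists lam : R,
  (forall (t : Z) (x y : V), a (vsval t) (vsval x) (vsval y) = lam * gV (j t x) y) /\
  exists w : Z -> Z -> Z,
    (forall r s t : Z, a (vsval r) (vsval s) (vsval t) = gZ (w r s) t) /\
    (forall r s, j (w r s) = (2 * lam) *: lie (j r) (j s)).
Proof.
have [|||A [AE _]] := @dot_represent R V gV Z
    (fun (t : Z) (x y : V) => a (vsval t) (vsval x) (vsval y)).
- by move=> x y c s t; rewrite linearP /= !(alt3E aA).
- by move=> t y c x x'; rewrite linearP /= !(alt3E aA).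
- by move=> t x c y y'; rewrite linearP /= !(alt3E aA).
have [|||w [wE _]] := @dot_represent R Z gZ Z
    (fun r s t : Z => a (vsval r) (vsval s) (vsval t)).
- by move=> x y c s t; rewrite linearP /= !(alt3E aA).
- by move=> t y c x x'; rewrite linearP /= !(alt3E aA).
- by move=> t x c y y'; rewrite linearP /= !(alt3E aA).
have A_skew t x y : gV (A t x) y = - gV x (A t y).
  by rewrite [gV x _]dotC !AE (alt3_23 aA).
pose P (c t : Z) (x b : V) := a (vsval c) (vsval (j t x)) (vsval b).
pose W (c t : Z) (x b : V) := a (vsval c) (vsval t) (vsval (vbracket x b)).
have main c t x b : - 2 * P c t x b + P c t b x + P t c x b + W c t x b = 0.
  have := killing3_polar (vsval x) (vsval t) (vsval b) (vsval c) aA aK.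
  rewrite nabla_vz !nabla_zv nabla_vv nabla_zz nabla_vz !(alt3E aA) /P /W.
  rewrite (alt3_23 aA (vsval (j t x))) (alt3_12 aA (vsval (j t x))).
  rewrite (alt3_13 aA (vsval x)).
  rewrite (alt3_13 aA (vsval t) _ (vsval c)) (alt3_23 aA (vsval c) _ (vsval t)).
  rewrite (alt3_23 aA (vsval t) (vsval b)).
  lra.
have Wxb c t x b : W c t b x = - W c t x b.
  by rewrite /W vbracketC linearN (alt3E aA).
have Wct c t x b : W t c x b = - W c t x b by rewrite /W (alt3_12 aA).
have PE c t x b : P t c x b = P c t b x /\ W c t x b = 2 * (P c t x b - P c t b x).
  have := main c t x b; have := main t c x b; have := main c t b x.
  have := main t c b x; rewrite (Wxb c) (Wxb t) Wct.
  by move=> *; split; lra.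
have AP s t x b : gV (A t (j s x)) b = P t s x b by rewrite AE.
have [||lam lamE] := exchange_scalar jmap_skew jmap_faithful
  vbracket_jmap jmap_indecomposable A_skew.
- move=> t s x; apply: (dot_inj (g := gV)) => b.
  rewrite AP jmap_skew A_skew opprK dotC AP.
  exact: (PE s t x b).1.
- move=> x b c; rewrite !AE.
  have := aK (vsval x) (vsval b) (vsval c).
  rewrite !nabla_vv vbracketxx !linear0 !(alt3E aA).
  rewrite (alt3_12 aA (vsval x)) (alt3_13 aA (vsval x)).
  rewrite (alt3_23 aA _ (vsval b) (vsval x)); lra.
exists lam; split=> [t x y|]; first by rewrite -AE lamE dotZl.
exists (fun r s => w r s); split=> [r s t|r s]; first by rewrite wE.
apply/lfunP => x; apply: (dot_inj (g := gV)) => b.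
rewrite -vbracket_jmap wE -/(W r s x b) (PE r s x b).2.
rewrite -!AP !lamE scale_lfunE !dotZl.
rewrite /= add_lfunE opp_lfunE !comp_lfunE dotBl.
rewrite (jmap_skew s) (jmap_skew r (j s b)) (dotC _ (j r x)); ring.
Qed.

End KillingThreeForm.

Lemma alt3_eq_vz (a b : n -> n -> n -> R) : alt3 a -> alt3 b ->
  (forall x y w : V, a (vsval x) (vsval y) (vsval w) =
                     b (vsval x) (vsval y) (vsval w)) ->
  (forall (t : Z) (x y : V), a (vsval t) (vsval x) (vsval y) =
                             b (vsval t) (vsval x) (vsval y)) ->
  (forall (x : V) (s t : Z), a (vsval x) (vsval s) (vsval t) =
                             b (vsval x) (vsval s) (vsval t)) ->
  (forall r s t : Z, a (vsval r) (vsval s) (vsval t) =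
                     b (vsval r) (vsval s) (vsval t)) ->
  forall x y w, a x y w = b x y w.
Proof.
move=> aA bA vvv zvv vzz zzz x y w; rewrite (vzE x) (vzE y) (vzE w).
have vzv (x' : V) (s : Z) (y' : V) : a (vsval x') (vsval s) (vsval y') =
    b (vsval x') (vsval s) (vsval y').
  by rewrite (alt3_12 aA) (alt3_12 bA) zvv.
have vvz (x' y' : V) (s : Z) : a (vsval x') (vsval y') (vsval s) =
    b (vsval x') (vsval y') (vsval s).
  by rewrite (alt3_23 aA) (alt3_23 bA) vzv.
have zvz (x' : V) (s t : Z) : a (vsval s) (vsval x') (vsval t) =
    b (vsval s) (vsval x') (vsval t).
  by rewrite (alt3_12 aA) (alt3_12 bA) vzz.
have zzv (x' : V) (s t : Z) : a (vsval s) (vsval t) (vsval x') =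
    b (vsval s) (vsval t) (vsval x').
  by rewrite (alt3_23 aA) (alt3_23 bA) zvz.
by rewrite !(alt3E aA) !(alt3E bA) vvv zvv vzz zzz vzv vvz zvz zzv.
Qed.

Section CanonicalForm.
(** [h s t] plays the role of the preimage under [j] of the commutator of [j s]
    and [j t]. *)
Variable h : Z -> 'End(Z).
Hypothesis jh : forall s t, j (h s t) = lie (j s) (j t).
Hypothesis h_skew : forall s t r, gZ (h s t) r = - gZ t (h s r).

Definition canonical_form (x y w : n) : R :=
  cubic_form gV gZ j h (vproj x) (zproj x) (vproj y) (zproj y) (vproj w) (zproj w).

Lemma canonical_form_alt3 : alt3 canonical_form.
Proof.
rewrite /canonical_form; split=> [y w c x x'|x y w|x y w].
- by rewrite !linearP /= (cubic_form_linear _ _ jmap_inj jh).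
- exact: (cubic_form_swap12 _ jmap_skew jmap_inj jh).
- exact: (cubic_form_swap23 jmap_skew h_skew).
Qed.

Lemma canonical_form_killing : killing3 nabla canonical_form.
Proof.
move=> y b c; rewrite /canonical_form !vproj_nabla !zproj_nabla.
exact: (cubic_form_killing jmap_skew vbracket_jmap jmap_inj jh h_skew).
Qed.

Lemma canonical_form_zvv (t : Z) (x y : V) :
  canonical_form (vsval t) (vsval x) (vsval y) = gV (j t x) y.
Proof.
rewrite /canonical_form /cubic_form !vproj_v !vproj_z !zproj_v !zproj_z.
by rewrite !linear0 ?zero_lfunE dot0l mulr0 !addr0.
Qed.

Lemma canonical_form_zzz (r s t : Z) :
  canonical_form (vsval r) (vsval s) (vsval t) = 2 * gZ (h r s) t.
Proof.
rewrite /canonical_form /cubic_form !vproj_z !zproj_z.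
by rewrite !linear0 !add0r.
Qed.

Lemma canonical_form_neq0 : canonical_form <> (fun _ _ _ => 0).
Proof.
move=> cf0; case: two_step => ab _; apply: ab => x y.
rewrite lie_vproj; set b := vbracket _ _.
have := canonical_form_zvv b (vproj x) (vproj y).
by rewrite cf0 -vbracket_jmap => /esym/(dot_eq0 (g := gZ)) ->; rewrite linear0.
Qed.

(** Both forms have vanishing odd components, and [killing3_scalar] gives the
    even ones: [j] being injective, its equation for [w] says
    [w = 2 lam h]. *)
Lemma killing3_canonical a : alt3 a -> killing3 nabla a ->
  exists lam, forall x y w, a x y w = lam * canonical_form x y w.
Proof.
move=> aA aK; have [lam [zvv [w0 [w0E jw]]]] := killing3_scalar aA aK.
have cA := canonical_form_alt3; have cK := canonical_form_killing.
exists lam; apply: alt3_eq_vz => //.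
- split=> [y w c x x'|x y w|x y w].
  + by rewrite (alt3_lin1 cA); ring.
  + by rewrite (alt3_12 cA); ring.
  + by rewrite (alt3_23 cA); ring.
- by move=> x y w; rewrite (killing3_vvv aA aK) (killing3_vvv cA cK) mulr0.
- by move=> t x y; rewrite zvv canonical_form_zvv.
- by move=> x s t; rewrite (killing3_vzz aA aK) (killing3_vzz cA cK) mulr0.
move=> r s t; rewrite w0E canonical_form_zzz.
have -> : w0 r s = (2 * lam) *: h r s.
  by have /lker0P jI := jmap_inj; apply: jI; rewrite jw linearZ /= jh.
by rewrite dotZl; ring.
Qed.

End CanonicalForm.

(** The scalar [lam] of [killing3_scalar] cannot be zero, as all components
    would vanish, so [w / (2 lam)] provides the preimages of commutators; it is
    written as a composite with [j^-1] to be linear by construction. *)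
Lemma killing3_closed a : alt3 a -> killing3 nabla a -> a <> (fun _ _ _ => 0) ->
  exists h : Z -> 'End(Z), (forall s t, j (h s t) = lie (j s) (j t)) /\
    (forall s t r, gZ (h s t) r = - gZ t (h s r)).
Proof.
move=> aA aK a0; have [lam [zvv [w [wE jw]]]] := killing3_scalar aA aK.
have /lker0P jI := jmap_inj.
have lam0 : lam != 0.
  apply/eqP => lam0; apply: a0; apply/funext => x; apply/funext => y.
  apply/funext => u; move: x y u; apply: alt3_eq_vz => //.
  - by split=> [? ? ? ? ?|? ? ?|? ? ?] /=; rewrite ?mulr0 ?addr0 ?oppr0.
  - exact: killing3_vvv.
  - by move=> t x y; rewrite zvv lam0 mul0r.
  - exact: killing3_vzz.
  move=> r s t; rewrite wE [w r s](_ : _ = 0) ?dot0l //.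
  by apply: jI; rewrite jw lam0 mulr0 scale0r linear0.
have lam2 : 2 * lam != 0 by rewrite mulf_neq0 // pnatr_eq0.
exists (fun s => (j^-1 \o ad (j s) \o j)%VF).
have hE s t : (j^-1 \o ad (j s) \o j)%VF t = (2 * lam)^-1 *: w s t.
  rewrite !comp_lfunE adE; apply: jI; rewrite limg_lfunVK.
    by rewrite linearZ /= jw scalerA mulVf // scale1r.
  have -> : lie (j s) (j t) = j ((2 * lam)^-1 *: w s t).
    by rewrite linearZ /= jw scalerA mulVf // scale1r.
  exact: memv_img (memvf _).
split=> [s t|s t r].
  by rewrite hE linearZ /= jw scalerA mulVf // scale1r.
by rewrite !hE dotZl dotZr [gZ t _]dotC -!wE (alt3_23 aA); ring.
Qed.


End TwoStep.

(** * Existence and uniqueness of Killing 3-forms *)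

Local Open Scope classical_set_scope.

Theorem proposition5p8 (R : realType) (n : lieAlgType R)
  (g : {dot n for idfun})
  (nabla : 'Hom(n, 'End(n)))
  (j : 'Hom(subvs_of (center n), 'End(subvs_of (orthov g (center n))))) :
  two_step_nilpotent n ->
  irreducible g ->
  levi_civita g nabla ->
  is_jmap g j ->
  ((exists2 alpha : kform n 3, killing_form nabla alpha & alpha <> (fun=> 0))
   <->
   lie_subalgebra_of_so (subdot g (orthov g (center n))) (limg j) /\
   (forall t : subvs_of (center n),
      so (subdot g (center n)) (j^-1 \o ad (j t) \o j)%VF)) /\
  ((exists2 alpha : kform n 3, killing_form nabla alpha & alpha <> (fun=> 0)) ->
   one_dimensional [set alpha : kform n 3 | killing_form nabla alpha]).
Proof.
move=> two_step irr lc jP; have tor := lc.1.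
have killP al := killing_form3 al tor.
have to_h : (exists2 al : kform n 3, killing_form nabla al & al <> (fun=> 0)) ->
    exists h : _ -> 'End(subvs_of (center n)),
      (forall s t, j (h s t) = lie (j s) (j t)) /\
      (forall s t r, subdot g _ (h s t) r = - subdot g _ t (h s r)).
  move=> [al /killP[aA aK] al0]; apply: (killing3_closed two_step jP irr lc aA aK).
  by move=> a0; apply: al0; rewrite -[al]fun3K a0.
split; first split.
- move=> /to_h[h [jh h_skew]]; split; first split.
  + by move=> f /memv_imgP[t _ ->]; apply: jmap_so.
  + apply/brackvP => _ _ /memv_imgP[s _ ->] /memv_imgP[t _ ->].
    by rewrite -jh memv_img // memvf.
  move=> t x y; have hE u : (j^-1 \o ad (j t) \o j)%VF u = h t u.
    by rewrite !comp_lfunE adE -jh lker0_lfunK // jmap_inj.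
  by rewrite !hE; apply: h_skew.
- case=> [[_ j_sub] h_so].
  pose h s := (j^-1 \o ad (j s) \o j)%VF.
  have jh s t : j (h s t) = lie (j s) (j t).
    rewrite !comp_lfunE adE limg_lfunVK //.
    by move/brackvP: j_sub; apply; apply: memv_img; apply: memvf.
  have h_skew s t r : subdot g _ (h s t) r = - subdot g _ t (h s r) := h_so s t r.
  exists (form3 (canonical_form j h)).
    apply/killP; rewrite form3K; split.
      exact: canonical_form_alt3.
    exact: canonical_form_killing.
  move=> /(congr1 (@fun3 R n)); rewrite form3K.
  exact: canonical_form_neq0.
move=> /to_h[h [jh h_skew]].
have cA := canonical_form_alt3 two_step jP irr jh h_skew.
have cK := canonical_form_killing two_step jP irr lc jh h_skew.
exists (form3 (canonical_form j h)).
  move=> /(congr1 (@fun3 R n)); rewrite form3K.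
  exact: canonical_form_neq0.
apply/seteqP; split=> [al /killP[aA aK]|_ [c _ <-]].
  have [lam lamE] := killing3_canonical two_step jP irr lc jh h_skew aA aK.
  exists lam => //; rewrite -[RHS]fun3K; apply/funext => x.
  by rewrite /form3 lamE.
apply/killP; split.
  split=> [y w d x x'|x y w|x y w]; rewrite /fun3 /form3 /=.
  + by rewrite (alt3_lin1 cA); ring.
  + by rewrite (alt3_12 cA); ring.
  + by rewrite (alt3_23 cA); ring.
by move=> y b d; rewrite /fun3 /form3 /= -!mulrDr cK mulr0.
Qed.
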